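(* Fix a positive integer $n$ and let $J\in\mathbb{C}^{n\times n}$ be the upper triangular Jordan block with ones on the superdiagonal and zeros everywhere else. Then there exist $c_n>0$ and $\delta_n>0$ such that for all $E\in\mathbb{C}^{n\times n}$ with $\|E\|\le 1$ and all $0<\delta<\delta_n$, $$\kappa_V(J+\delta E)\ge\frac{c_n}{\delta^{1-1/n}}.$$
   Context: $\|\cdot\|$ denotes the operator norm (spectral norm) of a matrix. For $M\in\mathbb{C}^{n\times n}$, the eigenvector condition number is $$\kappa_V(M)=\inf_{V:\,M=VDV^{-1}}\|V\|\,\|V^{-1}\|,$$ where the infimum is over all invertible $V\in\mathbb{C}^{n\times n}$ for which $M=VDV^{-1}$ with $D$ diagonal; $\kappa_V(M)=\infty$ if $M$ is not diagonalizable. *)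

(* Defs.v *)
From HB Require Import structures.
From mathcomp Require Import all_boot all_order all_algebra.
From mathcomp Require Export complex.
From mathcomp Require Import boolp classical_sets reals constructive_ereal ereal exp.
Set Implicit Arguments.
Unset Strict Implicit.
Unset Printing Implicit Defensive.
Import Order.TTheory GRing.Theory Num.Theory.
Import ComplexField.Normc.
Local Open Scope classical_set_scope.
Local Open Scope ring_scope.

(* [normc : R[i] -> R] is the complex modulus; the library's canonical norm on
   matrices is the max norm, hence the explicit Euclidean norm. *)
Definition l2norm (R : realType) (n : nat) (x : 'cV[R[i]]_n) : R :=
  Num.sqrt (\sum_i normc (x i 0) ^+ 2).

Definition opnorm (R : realType) (m n : nat) (M : 'M[R[i]]_(m, n)) : R :=
  sup [set l2norm (M *m x) | x in [set x | l2norm x <= 1]].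

(* [sup] is 0 on sets without a least upper bound; that case never occurs. *)
Lemma opnorm_has_sup (R : realType) (m n : nat) (M : 'M[R[i]]_(m, n)) :
  has_sup [set l2norm (M *m x) | x in [set x | l2norm x <= 1]].
Proof.
split.
  exists (l2norm (M *m 0)), 0 => //=.
  rewrite /l2norm big1 ?sqrtr0 ?ler01// => i _.
  by rewrite mxE normc0 expr0n.
have nc0 (z : R[i]) : 0 <= normc z by case: z => a b; exact: sqrtr_ge0.
have ncsum k (F : 'I_k -> R[i]) : normc (\sum_i F i) <= \sum_i normc (F i).
  elim/big_ind2: _ => //[|a b c d ab cd]; first by rewrite normc0.
  exact: le_trans (le_normcD _ _) (lerD ab cd).
exists (Num.sqrt (\sum_i (\sum_j normc (M i j)) ^+ 2)) => _ [x /= x1 <-].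
apply/ler_wsqrtr/ler_sum => i _.
have x1' j : normc (x j 0) <= 1.
  apply: le_trans x1; rewrite -[leLHS]ger0_norm// -sqrtr_sqr.
  apply: ler_wsqrtr; rewrite (bigD1 j)//= lerDl.
  by apply: sumr_ge0 => k _; exact: sqr_ge0.
rewrite ler_sqr ?nnegrE//; last by apply: sumr_ge0.
rewrite mxE; apply: le_trans (ncsum _ _) _; apply: ler_sum => j _.
by rewrite normcM -[leRHS]mulr1 ler_wpM2l.
Qed.

(* The infimum of the empty set is +oo, so kappaV M = +oo when M is not
   diagonalizable. *)
Definition kappaV (R : realType) (n : nat) (M : 'M[R[i]]_n) : \bar R :=
  ereal_inf [set (opnorm V * opnorm (invmx V))%:E | V in
    [set V : 'M[R[i]]_n | V \in unitmx /\
      exists2 D : 'M[R[i]]_n, is_diag_mx D & M = V *m D *m invmx V]].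

Definition jordan_block0 (R : realType) (n : nat) : 'M[R[i]]_n :=
  \matrix_(i, j) ((j : nat) == i.+1)%:R.

(* Main.v *)
(** The rate comes from the [n]-th and [(n-1)]-st powers of [M = J + delta E].
    Since [J ^ n = 0], the matrix [M ^ n] is [O(delta)], so every eigenvalue of
    [M] is [O(delta ^ (1/n))]. Since [J ^ (n-1)] has a corner entry [1], the
    matrix [M ^ (n-1)] stays of order [1]. If [M = V D V^-1] then
    [M ^ (n-1) = V D ^ (n-1) V^-1] with [D ^ (n-1) = O(delta ^ (1 - 1/n))], and
    [V], [V^-1] have to make up for the difference. Constants depending on [n]
    are free, so the entrywise l1 norm replaces the operator norm. *)
Require Import Defs.
From mathcomp Require Import all_boot all_order all_algebra.
From mathcomp Require Import complex reals constructive_ereal exp.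
From mathcomp Require Import ereal lra.
Set Implicit Arguments.
Unset Strict Implicit.
Unset Printing Implicit Defensive.
Import Order.TTheory GRing.Theory Num.Theory.
Import ComplexField.Normc.
Local Open Scope ring_scope.

(** Submultiplicative with no dimension factor, and a finite sum, so the estimates on powers avoid
    suprema. *)
Definition l1norm (R : realType) (m n : nat) (A : 'M[R[i]]_(m, n)) : R :=
  \sum_i \sum_j normc (A i j).

Section EntrywiseNorm.
Variable R : realType.
Implicit Types (m n p k : nat) (z : R[i]).

Lemma normc_ge0 z : 0 <= normc z.
Proof. by case: z => a b; exact: sqrtr_ge0. Qed.

Lemma normc_sum (I : Type) (r : seq I) (F : I -> R[i]) :
  normc (\sum_(i <- r) F i) <= \sum_(i <- r) normc (F i).
Proof.
elim/big_ind2: _ => [|a b c d ab cd|//]; first by rewrite normc0.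
exact: le_trans (le_normcD _ _) (lerD ab cd).
Qed.

Lemma normcX z k : normc (z ^+ k) = normc z ^+ k.
Proof. by elim: k => [|k IHk]; rewrite ?expr0 ?normc1 // !exprS normcM IHk. Qed.

Lemma normc_real (x : R) : normc (x%:C)%C = `|x|.
Proof. by rewrite /= expr0n addr0 sqrtr_sqr. Qed.

Lemma l1norm_ge0 m n (A : 'M[R[i]]_(m, n)) : 0 <= l1norm A.
Proof. by do 2!apply: sumr_ge0 => ? _; exact: normc_ge0. Qed.

Lemma normc_le_l1norm m n (A : 'M[R[i]]_(m, n)) i j : normc (A i j) <= l1norm A.
Proof.
rewrite /l1norm (bigD1 i) //= (bigD1 j) //= -addrA lerDl addr_ge0 //.
  by apply: sumr_ge0 => ? _; exact: normc_ge0.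
by do 2!apply: sumr_ge0 => ? _; exact: normc_ge0.
Qed.

Lemma l1norm_eq0 m n (A : 'M[R[i]]_(m, n)) : l1norm A = 0 -> A = 0.
Proof.
move=> A0; apply/matrixP => i j; rewrite mxE; apply: eq0_normc.
by apply/le_anti; rewrite normc_ge0 andbT -A0 normc_le_l1norm.
Qed.

Lemma l1normD m n (A B : 'M[R[i]]_(m, n)) :
  l1norm (A + B) <= l1norm A + l1norm B.
Proof.
rewrite /l1norm -big_split; apply: ler_sum => i _.
rewrite -big_split; apply: ler_sum => j _.
by rewrite mxE le_normcD.
Qed.

Lemma l1normZ m n z (A : 'M[R[i]]_(m, n)) : l1norm (z *: A) = normc z * l1norm A.
Proof.
rewrite /l1norm mulr_sumr; apply: eq_bigr => i _.
by rewrite mulr_sumr; apply: eq_bigr => j _; rewrite mxE normcM.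
Qed.

Lemma l1normM m n p (A : 'M[R[i]]_(m, n)) (B : 'M[R[i]]_(n, p)) :
  l1norm (A *m B) <= l1norm A * l1norm B.
Proof.
rewrite {1 2}/l1norm mulr_suml; apply: ler_sum => i _.
rewrite (le_trans (y := \sum_j \sum_k normc (A i k) * normc (B k j))) //.
  apply: ler_sum => j _; rewrite mxE (le_trans (normc_sum _ _)) //.
  by apply: ler_sum => k _; rewrite normcM.
rewrite exchange_big mulr_suml; apply: ler_sum => k _ /=.
rewrite -mulr_sumr ler_wpM2l ?normc_ge0 //.
rewrite /l1norm (bigD1 k) //= lerDl.
by do 2!apply: sumr_ge0 => ? _; exact: normc_ge0.
Qed.

Lemma l1norm_diag n (d : 'rV[R[i]]_n) :
  l1norm (diag_mx d) = \sum_i normc (d 0 i).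
Proof.
apply: eq_bigr => i _; rewrite (bigD1 i) //= big1 => [|j ji].
  by rewrite mxE eqxx mulr1n addr0.
by rewrite mxE eq_sym (negbTE ji) mulr0n normc0.
Qed.

Lemma normc_le_opnorm m n (A : 'M[R[i]]_(m, n)) i j : normc (A i j) <= opnorm A.
Proof.
rewrite (le_trans (y := l2norm (A *m delta_mx j 0))) //.
  rewrite -[leLHS]ger0_norm ?normc_ge0 // -sqrtr_sqr ler_wsqrtr //.
  rewrite -colE (bigD1 i) //= mxE lerDl.
  by apply: sumr_ge0 => ? _; exact: sqr_ge0.
apply: (sup_upper_bound (opnorm_has_sup A)); exists (delta_mx j 0) => //=.
rewrite /l2norm (bigD1 j) //= big1 => [|k kj].
  by rewrite mxE !eqxx normc1 addr0 expr1n sqrtr1.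
by rewrite mxE (negbTE kj) normc0 expr0n.
Qed.

(** Bridge from the operator norm: it turns the hypothesis on [E] into an l1 bound, and l1 lower
    bounds for [V] and [invmx V] into operator norm ones. *)
Lemma l1norm_le_opnorm m n (A : 'M[R[i]]_(m, n)) :
  l1norm A <= (m * n)%:R * opnorm A.
Proof.
rewrite (le_trans (y := \sum_(i < m) \sum_(j < n) opnorm A)) //.
  by do 2!apply: ler_sum => ? _; exact: normc_le_opnorm.
by rewrite !sumr_const !card_ord -mulrnA mulr_natl mulnC.
Qed.

(** Induction through $(A+B)^{k+1}-A^{k+1}=(A+B)((A+B)^k-A^k)+BA^k$. As [l1norm B <= 1], the factor
    $A+B$ costs at most [l1norm A + 1], so [C] depends on [A] and [k] alone. *)
Lemma l1norm_exp_perturb n (A : 'M[R[i]]_n) k :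
  exists2 C : R, 1 <= C &
    forall B : 'M[R[i]]_n, l1norm B <= 1 ->
      l1norm ((A + B) ^+ k - A ^+ k) <= C * l1norm B.
Proof.
elim: k => [|k [C C1 IHk]].
  exists 1 => // B _; rewrite !expr0 subrr mul1r.
  rewrite (le_trans _ (l1norm_ge0 B)) // /l1norm big1 // => i _.
  by rewrite big1 // => j _; rewrite mxE normc0.
have A0 := l1norm_ge0 A; have Ak0 := l1norm_ge0 (A ^+ k).
exists ((l1norm A + 1) * C + l1norm (A ^+ k)) => [|B B1]; first by nra.
have -> : (A + B) ^+ k.+1 - A ^+ k.+1
    = (A + B) *m ((A + B) ^+ k - A ^+ k) + B *m A ^+ k.
  by rewrite !exprS mulmxBr [(A + B) *m A ^+ k]mulmxDl opprD addrA subrK.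
rewrite (le_trans (l1normD _ _)) // mulrDl lerD //; last first.
  by rewrite (le_trans (l1normM _ _)) // mulrC.
rewrite (le_trans (l1normM _ _)) // -mulrA ler_pM ?l1norm_ge0 ?IHk //.
by rewrite (le_trans (l1normD _ _)) // lerD2l.
Qed.

Lemma diag_mxX n (d : 'rV[R[i]]_n) k :
  diag_mx d ^+ k = diag_mx (\row_j d 0 j ^+ k).
Proof.
elim: k => [|k IHk].
  by apply/matrixP => i j; rewrite !mxE expr0.
rewrite exprS IHk -[LHS]/(_ *m _) mulmx_diag; congr diag_mx.
by apply/rowP => j; rewrite !mxE exprS.
Qed.

Lemma diagonalized_exp n (V D : 'M[R[i]]_n) k : V \in unitmx ->
  (V *m D *m invmx V) ^+ k = V *m D ^+ k *m invmx V.
Proof.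
move=> Vu; elim: k => [|k IHk]; first by rewrite !expr0 mulmx1 mulmxV.
by rewrite !exprS IHk -![(_ * _)]/(_ *m _) !mulmxA mulmxKV.
Qed.

(** Column [j] of [V] is a nonzero eigenvector of [M ^+ k] for [d 0 j ^+ k]; submultiplicativity
    applies to it and its norm cancels. *)
Lemma eigenvalue_exp_le n (M V : 'M[R[i]]_n) (d : 'rV[R[i]]_n) k j :
  V \in unitmx -> M = V *m diag_mx d *m invmx V ->
  normc (d 0 j) ^+ k <= l1norm (M ^+ k).
Proof.
move=> Vu ->; rewrite diagonalized_exp // diag_mxX.
set d' := \row_j _; set A := _ *m invmx V.
have Vj : d 0 j ^+ k *: col j V = A *m col j V.
  rewrite colE mulmxA mulmxKV // -!colE.
  by apply/colP => i; rewrite mul_mx_diag !mxE mulrC.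
have Vj0 : 0 < l1norm (col j V).
  rewrite lt_def l1norm_ge0 andbT; apply/eqP => /l1norm_eq0.
  rewrite colE => /(congr1 (mulmx (invmx V))); rewrite mulKmx // mulmx0.
  by move/matrixP => /(_ j 0)/eqP; rewrite !mxE !eqxx oner_eq0.
by rewrite -(ler_pM2r Vj0) -normcX -l1normZ Vj l1normM.
Qed.

Lemma jordan_block0X n k (i j : 'I_n) :
  (jordan_block0 R n ^+ k) i j = ((j : nat) == (i + k)%N)%:R.
Proof.
elim: k i => [|k IHk] i; first by rewrite expr0 mxE addn0 eq_sym.
rewrite exprS -[(_ * _)]/(_ *m _) mxE.
have [i1n|ni1] := ltnP i.+1 n.
  rewrite (bigD1 (Ordinal i1n)) //= big1 => [|l /negbTE li].
    by rewrite mxE eqxx mul1r addr0 IHk /= addSnnS.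
  rewrite mxE; move: li; rewrite -val_eqE /= => ->; exact: mul0r.
(* The last row of the block is zero, and the shifted index $i+k+1\ge n$ lies outside the matrix. *)
rewrite big1 => [|l _]; last first.
  by rewrite mxE ltn_eqF ?mul0r // (leq_trans (ltn_ord l)).
rewrite ltn_eqF // (leq_trans (ltn_ord j)) // (leq_trans ni1) //.
by rewrite addnS ltnS leq_addr.
Qed.

End EntrywiseNorm.

Theorem proposition4p1 (R : realType) (n : nat) (hn : (0 < n)%N) :
  exists c_n delta_n : R, 0 < c_n /\ 0 < delta_n /\
    forall (E : 'M[R[i]]_n) (delta : R),
      opnorm E <= 1 -> 0 < delta -> delta < delta_n ->
      ((c_n / delta `^ (1 - n%:R^-1))%:E <=
        kappaV (jordan_block0 R n + delta%:C%C *: E))%E.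
Proof.
set J := jordan_block0 R n; set N : R := n%:R.
have N0 : 0 < N by rewrite ltr0n.
have N1 : 1 <= N by rewrite ler1n.
have [C C1 HC] := l1norm_exp_perturb J n.
have [C' C'1 HC'] := l1norm_exp_perturb J n.-1.
have T0 : 0 < C * N ^+ 2 by nra.
set r := 1 - n%:R^-1.
have r0 : 0 <= r by rewrite subr_ge0 invf_le1.
have Tr0 : 0 < (C * N ^+ 2) `^ r by exact: powR_gt0.
(* In [c_n], 2 comes from the lower bound $1/2$ on $M^{n-1}$, $N^4$ from passing to operator norms
   for [V] and its inverse, one more $N$ from summing the eigenvalues, and the power from the
   eigenvalue bound. The choice of [delta_n] gives $C'N^2\delta<1/2$. *)
exists (2 * N ^+ 5 * (C * N ^+ 2) `^ r)^-1, (2 * N ^+ 2 * C')^-1.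
have K0 : 0 < 2 * N ^+ 2 * C' by nra.
split; first by rewrite invr_gt0 !mulr_gt0 ?exprn_gt0.
split; first by rewrite invr_gt0.
move=> E delta E1 d0 dlt; set M := _ + _.
have dr0 : 0 < delta `^ r by exact: powR_gt0.
have dE : l1norm (delta%:C%C *: E) <= N ^+ 2 * delta.
  rewrite l1normZ normc_real gtr0_norm // mulrC ler_pM2r //.
  rewrite (le_trans (l1norm_le_opnorm E)) // natrM -expr2.
  by rewrite ler_piMr ?exprn_ge0 ?ler0n.
have dK : delta * (2 * N ^+ 2 * C') < 1 by rewrite -ltr_pdivlMr // div1r.
have Nd0 : 0 < N ^+ 2 * delta by rewrite mulr_gt0 ?exprn_gt0.
have dE1 : l1norm (delta%:C%C *: E) <= 1 by nra.
have Mn : l1norm (M ^+ n) <= C * N ^+ 2 * delta.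
  have Jn0 : J ^+ n = 0.
    apply/matrixP => i j; rewrite jordan_block0X mxE ltn_eqF //.
    by rewrite (leq_trans (ltn_ord j)) // leq_addl.
  rewrite -[M ^+ n]subr0 -Jn0 (le_trans (HC _ dE1)) // -mulrA.
  by rewrite ler_wpM2l // (le_trans ler01).
(* The corner entry gives $J^{n-1}$ norm at least 1, and the perturbation removes less than
   $1/2$. *)
have Mn1 : 2^-1 <= l1norm (M ^+ n.-1).
  have JM : J ^+ n.-1 = M ^+ n.-1 + (-1) *: (M ^+ n.-1 - J ^+ n.-1).
    by rewrite scaleN1r opprB addrC subrK.
  have J1 : 1 <= l1norm (J ^+ n.-1).
    have n1n : (n.-1 < n)%N by rewrite prednK.
    have := normc_le_l1norm (J ^+ n.-1) (Ordinal hn) (Ordinal n1n).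
    by rewrite jordan_block0X eqxx normc1.
  have := l1normD (M ^+ n.-1) ((-1) *: (M ^+ n.-1 - J ^+ n.-1)).
  rewrite -JM l1normZ normcN normc1 mul1r.
  have := HC' _ dE1; rewrite -/M => HM.
  have : C' * l1norm (delta%:C%C *: E) <= C' * (N ^+ 2 * delta).
    by rewrite ler_wpM2l // (le_trans ler01).
  by lra.
(* It suffices to bound below for each diagonalizing [V]; with none, the claim is vacuous. *)
apply: le_ereal_inf_tmp => _ [V [Vu [D Ddiag MV]] <-].
rewrite lee_fin.
have [d DE] := diag_mxP _ Ddiag.
rewrite DE in MV.
have dle j : normc (d 0 j) ^+ n.-1 <= (C * N ^+ 2) `^ r * delta `^ r.
  rewrite -powRM ?(ltW T0) ?(ltW d0) //.
  (* Since $nr=n-1$. For $n=1$ both sides are 1, even at a zero eigenvalue. *)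
  have -> : normc (d 0 j) ^+ n.-1 = (normc (d 0 j) ^+ n) `^ r.
    rewrite -powR_mulrn ?normc_ge0 // -powR_mulrn ?normc_ge0 // -powRrM.
    congr (_ `^ _); rewrite /r mulrBr mulr1 divff ?gt_eqF //.
    by rewrite -{2}(prednK hn) -natr1 addrK.
  rewrite ge0_ler_powR ?nnegrE ?exprn_ge0 ?normc_ge0 //.
    by rewrite mulr_ge0 ?(ltW T0) ?(ltW d0).
  exact: le_trans (eigenvalue_exp_le n j Vu MV) Mn.
set L := _ * delta `^ r in dle.
have Dn1 : l1norm (diag_mx d ^+ n.-1) <= N * L.
  rewrite diag_mxX l1norm_diag.
  rewrite (le_trans (y := \sum_(j < n) L)) //.
    by apply: ler_sum => j _; rewrite mxE normcX.
  by rewrite sumr_const card_ord mulr_natl.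
have MV1 : l1norm (M ^+ n.-1) <= l1norm V * (N * L) * l1norm (invmx V).
  rewrite MV diagonalized_exp // (le_trans (l1normM _ _)) //.
  rewrite ler_wpM2r ?l1norm_ge0 // (le_trans (l1normM _ _)) //.
  by rewrite ler_wpM2l ?l1norm_ge0.
have L0 : 0 < L by rewrite mulr_gt0.
have op A : l1norm A <= N ^+ 2 * opnorm (A : 'M[R[i]]_n).
  by rewrite expr2 -natrM l1norm_le_opnorm.
have VV : l1norm V * l1norm (invmx V)
    <= N ^+ 4 * (opnorm V * opnorm (invmx V)).
  by rewrite (exprD _ 2 2) mulrACA ler_pM ?l1norm_ge0 ?op.
(* Clearing denominators leaves $1\le\|V\|\,\|V^{-1}\|\cdot 2N^5L$, which follows by chaining [Mn1],
   [MV1] and [VV]. *)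
rewrite -invfM -[X in X^-1]mulrA -/L -[leLHS]div1r ler_pdivrMr; last first.
  by rewrite !mulr_gt0 ?exprn_gt0.
have : l1norm V * l1norm (invmx V) * (N * L)
    <= N ^+ 4 * (opnorm V * opnorm (invmx V)) * (N * L).
  by rewrite ler_pM2r // mulr_gt0.
move: MV1 Mn1; clearbody L; by lra.
Qed.
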